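(* Let $N\ge 0$ be an integer and let $\lambda\neq 0$ be a complex number. Then the generating function of the hypergeometric degenerate Bernoulli numbers $\beta_{N,n}(\lambda)$ has the continued fraction expansion $$\sum_{n=0}^\infty\beta_{N,n}(\lambda)\frac{x^n}{n!}=1-\cfrac{(1-N\lambda)x}{N+1+(1-N\lambda)x-\cfrac{(N+1)\bigl(1-(N+1)\lambda\bigr)x}{N+2+\bigl(1-(N+1)\lambda\bigr)x-\cfrac{(N+2)\bigl(1-(N+2)\lambda\bigr)x}{N+3+\bigl(1-(N+2)\lambda\bigr)x-\ddots}}}\,,$$ i.e. the continued fraction $a_0+\cfrac{b_1}{a_1+\cfrac{b_2}{a_2+\ddots}}$ with $a_0=1$, $b_1=-(1-N\lambda)x$, $a_n=N+n+\bigl(1-(N+n-1)\lambda\bigr)x$ for $n\ge 1$, and $b_n=-(N+n-1)\bigl(1-(N+n-1)\lambda\bigr)x$ for $n\ge 2$.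
   Context: The hypergeometric degenerate Bernoulli numbers $\beta_{N,n}(\lambda)$ are defined by $$\left({}_2F_1(1,N-1/\lambda;N+1;-\lambda x)\right)^{-1}=\sum_{n=0}^\infty\beta_{N,n}(\lambda)\frac{x^n}{n!},$$ where ${}_2F_1(a,b;c;z)=\sum_{n=0}^\infty\frac{(a)^{(n)}(b)^{(n)}}{(c)^{(n)}}\frac{z^n}{n!}$ and $(y)^{(n)}=y(y+1)\cdots(y+n-1)$ for $n\ge 1$, $(y)^{(0)}=1$. Convention on continued fractions: for polynomials $a_n$ ($n\ge 0$), $b_n$ ($n\ge 1$) in $x$, the convergents $P_n/Q_n$ of $a_0+\cfrac{b_1}{a_1+\cfrac{b_2}{a_2+\ddots}}$ are defined by $P_{-1}=1$, $Q_{-1}=0$, $P_0=a_0$, $Q_0=1$, $P_n=a_nP_{n-1}+b_nP_{n-2}$, $Q_n=a_nQ_{n-1}+b_nQ_{n-2}$ ($n\ge 1$). A formal power series $f(x)$ has this continued fraction expansion (written as an equality) if for every $n\ge 0$ the power series expansion at $x=0$ of $P_n(x)/Q_n(x)$ agrees with $f(x)$ up to and including the term in $x^n$, i.e. $P_n/Q_n\equiv f\pmod{x^{n+1}}$; in particular $f=\lim_{n\to\infty}P_n/Q_n$ as formal power series. *)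

(* Defs.v *)
From mathcomp Require Import all_boot all_order all_algebra.

Set Implicit Arguments.
Unset Strict Implicit.
Unset Printing Implicit Defensive.

Import Order.TTheory GRing.Theory Num.Theory.
Local Open Scope ring_scope.

Section FormalPowerSeries.
Variable K : fieldType.

(* A formal power series over K is the sequence of its coefficients; two of
   them are compared with pointwise equality =1. *)
Definition fps := nat -> K.

Implicit Types f g : fps.

Definition fps_one : fps := fun n => (n == 0%N)%:R.

Definition fps_mul f g : fps := fun n => \sum_(i < n.+1) f i * g (n - i)%N.

(* The coefficients of degree 0, ..., n of the inverse g of f, solved from
   f g = 1: g_0 = f_0^-1 and g_n = - f_0^-1 \sum_(i < n) f_(n-i) g_i. *)
Fixpoint fps_inv_coefs f (n : nat) : seq K :=
  if n is m.+1 then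
    let s := fps_inv_coefs f m in
    rcons s (- (f 0%N)^-1 * \sum_(i < m.+1) f (m.+1 - i)%N * s`_i)
  else [:: (f 0%N)^-1].

(* Meaningful when f 0 != 0, see fps_mulfV. *)
Definition fps_inv f : fps := fun n => (fps_inv_coefs f n)`_n.

(* f (c x) *)
Definition fps_dilate (c : K) f : fps := fun n => c ^+ n * f n.

Definition fps_of_poly (p : {poly K}) : fps := fun n => p`_n.

Definition fps_eq_upto (n : nat) f g : Prop :=
  forall k : nat, (k <= n)%N -> f k = g k.

(* g is the power series expansion at x = 0 of the rational function P / Q;
   there is at most one such g, and exactly one as soon as Q(0) != 0. *)
Definition is_expansion (P Q : {poly K}) g : Prop :=
  Q != 0 /\ fps_mul (fps_of_poly Q) g =1 fps_of_poly P.

Lemma size_fps_inv_coefs f n : size (fps_inv_coefs f n) = n.+1.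
Proof. by elim: n => //= n IHn; rewrite size_rcons IHn. Qed.

Lemma nth_fps_inv_coefs f n i :
  (i <= n)%N -> (fps_inv_coefs f n)`_i = fps_inv f i.
Proof.
elim: n => [|n IHn]; first by rewrite leqn0 => /eqP ->.
rewrite leq_eqVlt => /predU1P [-> //|lt_in] /=.
by rewrite nth_rcons size_fps_inv_coefs lt_in IHn.
Qed.

Lemma fps_invS f n :
  fps_inv f n.+1
  = - (f 0%N)^-1 * \sum_(i < n.+1) f (n.+1 - i)%N * fps_inv f i.
Proof.
rewrite {1}/fps_inv /= nth_rcons size_fps_inv_coefs ltnn eqxx.
congr (_ * _); apply: eq_bigr => i _.
by rewrite nth_fps_inv_coefs // -ltnS.
Qed.

Lemma fps_mulfV f : f 0%N != 0 -> fps_mul f (fps_inv f) =1 fps_one.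
Proof.
move=> f0 [|n]; rewrite /fps_mul /fps_one.
  by rewrite big_ord1 subnn /fps_inv /= divff.
rewrite (reindex_inj rev_ord_inj) big_ord_recr /= subSS subnn subn0.
rewrite fps_invS mulrA mulrN divff // mulN1r.
apply/eqP; rewrite subr_eq0; apply/eqP; apply: eq_bigr => i _ /=.
by rewrite subSS subKn // ltnW.
Qed.

End FormalPowerSeries.

Section ContinuedFraction.
Variable K : fieldType.
Implicit Types a b : nat -> {poly K}.

(* The pair (X_n, X_(n-1)), where X_(-1) = u, X_0 = v and
   X_n = a_n X_(n-1) + b_n X_(n-2) for n >= 1; a_0 and b_0 are not used. *)
Fixpoint cf_rec a b (u v : {poly K}) (n : nat) : {poly K} * {poly K} :=
  if n is m.+1 then
    let: (x, y) := cf_rec a b u v m in (a m.+1 * x + b m.+1 * y, x)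
  else (v, u).

Definition cf_num a b (n : nat) : {poly K} := (cf_rec a b 1 (a 0%N) n).1.

Definition cf_den a b (n : nat) : {poly K} := (cf_rec a b 0 1 n).1.

Definition has_cf_expansion (f : fps K) a b : Prop :=
  forall n : nat, exists g : fps K,
    is_expansion (cf_num a b n) (cf_den a b n) g /\ fps_eq_upto n g f.

End ContinuedFraction.

Section HypergeometricDegenerateBernoulli.
Variable K : fieldType.

Definition rising (y : K) (n : nat) : K := \prod_(i < n) (y + i%:R).

Definition hypergeom2F1 (a b c : K) : fps K :=
  fun n => rising a n * rising b n / rising c n / (n`!)%:R.

Definition hdbernoulli (N : nat) (lambda : K) (n : nat) : K :=
  (n`!)%:R *
  fps_inv (fps_dilate (- lambda)
             (hypergeom2F1 1 (N%:R - 1 / lambda) (N%:R + 1))) n.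

(* \sum_n u_n x^n / n! *)
Definition egf (u : nat -> K) : fps K := fun n => u n / (n`!)%:R.

Definition hdb_cf_a (N : nat) (lambda : K) (n : nat) : {poly K} :=
  if n == 0%N then 1
  else ((N + n)%:R)%:P + (1 - (N + n - 1)%:R * lambda) *: 'X.

(* The value at n = 0 is irrelevant. *)
Definition hdb_cf_b (N : nat) (lambda : K) (n : nat) : {poly K} :=
  if (n <= 1)%N then - ((1 - N%:R * lambda) *: 'X)
  else - (((N + n - 1)%:R * (1 - (N + n - 1)%:R * lambda)) *: 'X).

End HypergeometricDegenerateBernoulli.

(* Main.v *)
(* The inverted hypergeometric series is the sum of the f_n x^n with
   f_n = r_0 ... r_(n-1) and r_i = (1 - (N + i) lambda) / (N + 1 + i). In terms
   of r the continued fraction is Euler's, rescaled by d_i = N + 1 + i: its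
   convergents are P_n = D_n and Q_n = D_n (f_0 + ... + f_n x^n), where
   D_n = d_0 ... d_(n-1), so that P_n / Q_n is the inverse of a truncation of
   the series. *)
Require Import Defs.
From mathcomp Require Import all_boot all_order all_algebra.
From mathcomp Require Import complex.
From mathcomp Require Import reals.
From mathcomp Require Import ring.

Import GRing.Theory.
Local Open Scope ring_scope.
Local Open Scope complex_scope.

(** By the recursion [fps_invS], coefficient [k] of an inverse involves only coefficients of index
    at most [k] of the series. *)
Lemma fps_inv_eq_upto (K : fieldType) (f g : fps K) (n : nat) :
  fps_eq_upto n f g -> fps_eq_upto n (fps_inv f) (fps_inv g).
Proof.
move=> fg k; elim/ltn_ind: k => -[|k] IHk le_kn.
  by rewrite /fps_inv /= fg.
rewrite !fps_invS fg //; congr (_ * _); apply: eq_bigr => i _.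
rewrite fg ?(leq_trans (leq_subr _ _)) // IHk //.
exact: leq_trans (ltnW (ltn_ord i)) le_kn.
Qed.

Section EulerContinuedFraction.
Variables (K : fieldType) (d r : nat -> K) (a b : nat -> {poly K}).

Let D n := \prod_(i < n) d i.
Let f : fps K := fun n => \prod_(i < n) r i.
Let F n := \poly_(i < n.+1) f i.

Hypothesis a0 : a 0%N = 1.
Hypothesis aS : forall n, a n.+1 = d n *: (1 + r n *: 'X).
Hypothesis b1 : b 1%N = - (d 0%N * r 0%N) *: 'X.
Hypothesis bSS : forall n, b n.+2 = - (d n * d n.+1 * r n.+1) *: 'X.

Let DS n : D n.+1 = D n * d n. Proof. exact: big_ord_recr. Qed.

Let fS n : f n.+1 = f n * r n. Proof. exact: big_ord_recr. Qed.

Let F0 : F 0 = 1.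
Proof. by rewrite /F poly_def big_ord1 /f big_ord0 scale1r. Qed.

Let FS n : F n.+1 = F n + f n.+1 *: 'X^(n.+1).
Proof. by rewrite /F !poly_def big_ord_recr. Qed.

(** The terms in ['X] cancel in the recurrence: [d n * D n = D n.+1] turns the contribution of
    [b n.+2] into the opposite of the one of [r n.+1 *: 'X] in [a n.+2]. *)
Lemma euler_cf_num n : cf_num a b n = (D n)%:P.
Proof.
rewrite /cf_num a0; case: n => [|n]; first by rewrite /D big_ord0.
(* The recurrence has order two, so the induction carries a pair; it starts at index 1, since at
   index 0 the second entry is the initial value of index -1. *)
suff -> : cf_rec a b 1 1 n.+1 = ((D n.+1)%:P, (D n)%:P) by [].
elim: n => [|n IHn].
  rewrite /= aS b1 DS /D big_ord0 -!mul_polyC.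
  by congr pair; rewrite !(polyCN, polyCM); ring.
rewrite [LHS]/= -/(cf_rec a b 1 1 n.+1) IHn aS bSS !DS -!mul_polyC.
by congr pair; rewrite !(polyCN, polyCM); ring.
Qed.

(** After division by [D n.+2], the recurrence reads [F n.+2 = F n.+1 + r n.+1 *: 'X * (F n.+1 - F
    n)], where the difference is the single term [f n.+1 *: 'X^(n.+1)]. *)
Lemma euler_cf_den n : cf_den a b n = D n *: F n.
Proof.
rewrite /cf_den; case: n => [|n]; first by rewrite F0 /D big_ord0 scale1r.
suff -> : cf_rec a b 0 1 n.+1 = (D n.+1 *: F n.+1, D n *: F n) by [].
elim: n => [|n IHn].
  rewrite /= aS b1 DS FS F0 fS /f /D !big_ord0 -!mul_polyC.
  by congr pair; rewrite ?(polyCN, polyCM); ring.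
rewrite [LHS]/= -/(cf_rec a b 0 1 n.+1) IHn aS bSS !DS !FS (fS n.+1).
rewrite -!mul_polyC (exprS _ n.+1).
by congr pair; rewrite ?(polyCN, polyCM); ring.
Qed.

Hypothesis d_neq0 : forall n, d n != 0.

Lemma euler_cf_expansion : has_cf_expansion (fps_inv f) a b.
Proof.
move=> n; exists (fps_inv (fps_of_poly (F n))).
have D_neq0 : D n != 0 by apply/prodf_neq0 => i _.
have F_0 : (F n)`_0 = 1 by rewrite coef_poly /f big_ord0.
have F_neq0 : F n != 0.
  by apply: contra_eq_neq F_0 => ->; rewrite coef0 eq_sym oner_neq0.
rewrite euler_cf_num euler_cf_den; split; last first.
  by apply: fps_inv_eq_upto => k le_kn; rewrite /fps_of_poly coef_poly ltnS le_kn.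
split=> [|k]; first by rewrite scaler_eq0 negb_or D_neq0.
(* The scalar [D n] of the denominator comes out of the product, and [F n] cancels against its
   inverse. *)
transitivity (D n * fps_one K k).
  rewrite -(@fps_mulfV _ (fps_of_poly (F n))) /fps_of_poly ?F_0 ?oner_neq0 //.
  by rewrite /fps_mul mulr_sumr; apply: eq_bigr => i _; rewrite coefZ mulrA.
by rewrite /fps_one /fps_of_poly coefC; case: eqP; rewrite ?mulr1 ?mulr0.
Qed.

End EulerContinuedFraction.

Lemma eq_has_cf_expansion (K : fieldType) (f g : fps K) (a b : nat -> {poly K}) :
  f =1 g -> has_cf_expansion f a b -> has_cf_expansion g a b.
Proof.
by move=> fg cf n; have [h [Ph hf]] := cf n; exists h; split=> // k /hf ->.
Qed.

Section HypergeometricDegenerateBernoulli.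
Variables (K : numFieldType) (N : nat) (lambda : K).

Let r n : K := (1 - (N + n)%:R * lambda) / (N + n.+1)%:R.

Let dnz n : (N + n.+1)%:R != 0 :> K.
Proof. by rewrite Num.Theory.pnatr_eq0 addnS. Qed.

Lemma rising1 n : rising 1 n = n`!%:R :> K.
Proof.
elim: n => [|n IHn]; first by rewrite /rising big_ord0.
by rewrite /rising big_ord_recr /= -/(rising 1 n) IHn factS mulnC natrM nat1r.
Qed.

(** The factor [rising 1 n] cancels the factorial, and one [- lambda] goes to each factor of the
    other quotient: [- lambda * (N - 1 / lambda + i) = 1 - (N + i) * lambda]. *)
Lemma fps_dilate_hypergeom2F1 : lambda != 0 ->
  fps_dilate (- lambda) (hypergeom2F1 1 (N%:R - 1 / lambda) (N%:R + 1))
  =1 (fun n => \prod_(i < n) r i).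
Proof.
move=> lambda_neq0 n.
have fact_neq0 : n`!%:R != 0 :> K by rewrite Num.Theory.pnatr_eq0 -lt0n fact_gt0.
rewrite /fps_dilate /hypergeom2F1 rising1 -2!(mulrA n`!%:R) (mulrC n`!%:R) divfK //.
rewrite /rising -[n in _ ^+ n]card_ord -prodr_const -prodf_div -big_split.
apply: eq_bigr => i _ /=; have := dnz i.
by rewrite /r addnS -natr1 !natrD => di; field; rewrite lambda_neq0 di.
Qed.

Lemma egf_hdbernoulli : lambda != 0 ->
  egf (hdbernoulli N lambda) =1 fps_inv (fun n => \prod_(i < n) r i).
Proof.
move=> lambda_neq0 n; rewrite /egf /hdbernoulli mulrC mulKf; last first.
  by rewrite Num.Theory.pnatr_eq0 -lt0n fact_gt0.
(* Pointwise equality of the inverses at [n] follows from agreement of the series up to order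
   [n]. *)
apply: (@fps_inv_eq_upto _ _ _ n) => // k _.
exact: fps_dilate_hypergeom2F1.
Qed.

Lemma hdbernoulli_cf_expansion : lambda != 0 ->
  has_cf_expansion (egf (hdbernoulli N lambda))
                   (hdb_cf_a N lambda) (hdb_cf_b N lambda).
Proof.
move=> lambda_neq0.
apply: (eq_has_cf_expansion _ _ _ _ _ (fsym (egf_hdbernoulli lambda_neq0))).
(* Scaling by [d n = N + n + 1] clears the denominator of [r n]; in [b n.+2] it leaves the factor
   [d n], which is the [N + n + 1] of [hdb_cf_b]. *)
have dr n : (N + n.+1)%:R * r n = 1 - (N + n)%:R * lambda.
  by rewrite mulrC divfK.
apply: (@euler_cf_expansion _ (fun n => (N + n.+1)%:R)) => //=.
- by move=> n; rewrite /hdb_cf_a /= scalerDr scalerA dr addnS subn1 alg_polyC.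
- by rewrite /hdb_cf_b /= dr addn0 scaleNr.
- by move=> n; rewrite /hdb_cf_b /= -mulrA dr scaleNr [(N + n.+2)%N]addnS subn1.
Qed.

End HypergeometricDegenerateBernoulli.

Theorem theorem1 (R : realType) (N : nat) (lambda : R[i]) (hlambda : lambda != 0) :
  has_cf_expansion (egf (hdbernoulli N lambda))
                   (hdb_cf_a N lambda) (hdb_cf_b N lambda).
Proof. exact: hdbernoulli_cf_expansion. Qed.
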